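(* Let $k\ge 3$ and let $G$ be a $k$-connected graph, and let $p$ be the length of a longest path in $G$. Define $t=\left\lfloor\sqrt{\frac{k-2}{2}}\right\rfloor$ if $p$ is even and $t=\left\lceil\sqrt{\frac{k-2}{2}}\right\rceil$ if $p$ is odd. Then there is a bond of $G$ meeting every path of $G$ of length at least $p-t+1$.
   Context: All graphs are finite, simple and undirected. The length of a path is its number of edges. A bond of $G$ is a minimal nonempty edge-cut, where an edge-cut is a set of edges of the form $\{xy\in E(G): x\in X, y\in V(G)\setminus X\}$ for some $X\subseteq V(G)$. A set of edges meets a path if the path contains at least one edge of the set. *)

(* Defs.v *)
From mathcomp Require Import all_boot all_order all_algebra algC.
Set Implicit Arguments. Unset Strict Implicit. Unset Printing Implicit Defensive.
Import Order.TTheory GRing.Theory Num.Theory.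

Definition simple_graph (T : finType) (e : rel T) : Prop :=
  symmetric e /\ irreflexive e.

Definition edges (T : finType) (e : rel T) : {set {set T}} :=
  [set [set x; y] | x in [set: T], y in [set: T] & e x y].

Definition edge_cut (T : finType) (e : rel T) (X : {set T}) : {set {set T}} :=
  [set [set x; y] | x in X, y in ~: X & e x y].

Definition is_edge_cut (T : finType) (e : rel T) (F : {set {set T}}) : Prop :=
  exists X : {set T}, F = edge_cut e X.

Definition is_bond (T : finType) (e : rel T) (B : {set {set T}}) : Prop :=
  [/\ is_edge_cut e B, B != set0 &
      forall C, is_edge_cut e C -> C != set0 -> C \subset B -> C = B].

Definition is_gpath (T : finType) (e : rel T) (s : seq T) : bool :=
  if s is x :: s' then path e x s' && uniq s else false.

Definition plength (T : Type) (s : seq T) : nat := (size s).-1.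

Definition path_edges (T : finType) (s : seq T) : seq {set T} :=
  if s is x :: s' then pairmap (fun a b => [set a; b]) x s' else [::].

Definition meets (T : finType) (F : {set {set T}}) (s : seq T) : bool :=
  has (fun f => f \in F) (path_edges s).

Definition k_connected (T : finType) (e : rel T) (k : nat) : Prop :=
  k < #|T| /\
  forall S : {set T}, #|S| < k ->
    forall x y, x \notin S -> y \notin S ->
      connect [rel a b | [&& e a b, a \notin S & b \notin S]] x y.

Definition longest_path_length (T : finType) (e : rel T) (p : nat) : Prop :=
  (exists s, is_gpath e s /\ plength s = p) /\
  (forall s, is_gpath e s -> plength s <= p).

(* sqrt((k-2)/2) as an algebraic (real) number; note k >= 3 in the theorem. *)
Definition sq_param (k : nat) : algC := sqrtC (((k - 2)%:R / 2%:R)%R).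

Definition t_param (k p : nat) : nat :=
  if odd p then `|Num.ceil (sq_param k)|%N else `|Num.floor (sq_param k)|%N.

(* Main.v *)
(* Idea.  An edge cut whose two sides induce connected graphs is a bond, and a
   path avoids it iff it lies on one side.  Call a path long if its length is at
   least p - t + 1.  If every bond misses a long path, start from a connected
   side containing a long path A and move vertices one at a time to the other
   side, keeping both sides connected; at some point the other side acquires a
   long path B, and A and B share at most one vertex.

   This is impossible.  By Dirac's argument A and B have at least k vertices
   each, so Menger's theorem gives k disjoint A-B links.  Let one of them (the
   trivial one at the common vertex, if there is one) be the hub; its ends cut
   A into arms A1, A2 and B into arms B1, B2.  Among the links between two arms
   of lengths u, w, Erdos and Szekeres provide m pairwise monotone ones, about
   the square root of their number; zigzagging along these from the hub, both
   ways, traverses the two arms entirely and every link twice, so one of the two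
   walks has length at least (u + w) / 2 + m.  Joining through the hub such a
   path in A1, B1 to one in A2, B2 (and similarly for A1, B2 and A2, B1) and
   comparing with p bounds the number of links by k - 2.  When p and t are odd
   and A, B have length exactly p - t + 1, one of a1 + b1, a1 + b2 is odd, and
   rounding (u + w) / 2 up gains the missing unit. *)
Require Import Defs.
From mathcomp Require Import all_boot all_order all_algebra algC.
From mathcomp Require Import zify.
From Stdlib Require Import Classical.
Set Implicit Arguments. Unset Strict Implicit. Unset Printing Implicit Defensive.
Import Order.TTheory GRing.Theory Num.Theory.

(** * Monotone links and zigzags *)
Section Sequences.
Variable T : eqType.
Implicit Types s t U W : seq T.

(** Multiset inclusion: an assembled walk is shown to be a path by comparing multiplicities with one
    duplicate-free list. *)
Definition msub s t := forall z, count_mem z s <= count_mem z t.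

Lemma msub_uniq s t : msub s t -> uniq t -> uniq s.
Proof.
move=> st ut; apply: count_mem_uniq => z.
move: (st z); rewrite (count_uniq_mem z ut) -(has_pred1 z s) has_count.
by case: (count_mem z s) => [|[|n]] //; case: (z \in t).
Qed.

Lemma subseq_cons_split a s U : subseq (a :: s) U ->
  exists U0 U1, U = U0 ++ a :: U1 /\ subseq s U1.
Proof.
elim: U => //= u U IH; case: eqP => [-> | _] sU; first by exists [::], U.
by have [U0 [U1 [-> sU1]]] := IH sU; exists (u :: U0), U1.
Qed.

(** Strictly sorted lists with the same elements coincide, so [s] is [U] filtered by membership in
    [s]. *)
Lemma sorted_index_subseq s U : uniq U -> {subset s <= U} ->
  sorted (relpre (index^~ U) ltn) s -> subseq s U.
Proof.
move=> uU sU sort_s.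
have tr : transitive (relpre (index^~ U) ltn) by move=> y x z /=; apply: ltn_trans.
have irr : irreflexive (relpre (index^~ U) ltn) by move=> x /=; rewrite ltnn.
have sortU : sorted (relpre (index^~ U) ltn) U.
  rewrite -sorted_map; have -> : map (index^~ U) U = iota 0 (size U).
    apply: (@eq_from_nth _ 0); rewrite size_map ?size_iota // => i iU.
    case: U iU uU {sU sort_s tr irr} => // u U iU uU.
    by rewrite (nth_map u) // index_uniq // nth_iota.
  exact: iota_ltn_sorted.
suff -> : s = filter (mem s) U by exact: filter_subseq.
apply: (irr_sorted_eq tr irr) => //; first exact: sorted_filter.
by move=> z; rewrite mem_filter inE /=; case: (boolP (z \in s)) => // /sU ->.
Qed.

End Sequences.

(** * The Erdős-Szekeres theorem *)

Section ErdosSzekeres.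
Variables (V : eqType) (f : V -> nat).
Implicit Types s t : seq V.

Fixpoint right_maxima s :=
  if s is x :: s' then
    if all (fun y => f y < f x) s' then x :: right_maxima s' else right_maxima s'
  else [::].

Fixpoint non_right_maxima s :=
  if s is x :: s' then
    if all (fun y => f y < f x) s' then non_right_maxima s' else x :: non_right_maxima s'
  else [::].

Lemma right_maxima_subseq s : subseq (right_maxima s) s.
Proof.
elim: s => //= x s IH; case: ifP => _ /=; first by rewrite eqxx.
exact: subseq_trans IH (subseq_cons _ _).
Qed.

Lemma non_right_maxima_subseq s : subseq (non_right_maxima s) s.
Proof.
elim: s => //= x s IH; case: ifP => _ /=; last by rewrite eqxx.
exact: subseq_trans IH (subseq_cons _ _).
Qed.

Lemma right_maxima_sorted s : sorted (relpre f gtn) (right_maxima s).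
Proof.
elim: s => //= x s IH; case: ifP => // /allP xs /=.
rewrite path_min_sorted //; apply/allP => y /(mem_subseq (right_maxima_subseq s)).
exact: xs.
Qed.

Lemma size_right_maxima s :
  size (right_maxima s) + size (non_right_maxima s) = size s.
Proof. by elim: s => //= x s IH; case: ifP => _ /=; lia. Qed.

(** The last term of the list is not a right maximum, so a later term is at least as large, and
    strictly larger because [f] takes distinct values on [s]. *)
Lemma non_right_maxima_extend s x t : uniq (map f s) ->
  subseq (x :: t) (non_right_maxima s) ->
  exists2 y, f (last x t) < f y & subseq (rcons (x :: t) y) s.
Proof.
elim: s x t => //= z s IH x t /andP[zs us].
case: ifP => [_ | /negbT/allPn[y ys yz]].
  by move=> /(IH _ _ us)[y xy /= st]; exists y => //; case: eqP => // _; apply: (cons_subseq st).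
rewrite /=; case: eqP => [-> | _].
  case: t => [|x' t].
    move=> _; exists y => /=; last by rewrite sub1seq.
    rewrite ltn_neqAle leqNgt yz andbT; apply: contra zs => /eqP ->.
    exact: map_f.
  by move=> /(IH _ _ us)[y' xy /= st]; exists y'.
by move=> /(IH _ _ us)[y' xy /= st]; exists y'.
Qed.

(** The right maxima decrease. If there are at most [q] of them, removing them costs one unit of
    [r], which is regained by prolonging the increasing list found among the rest. *)
Lemma erdos_szekeres r q s : uniq (map f s) -> r * q < size s ->
  (exists t, [/\ subseq t s, sorted (relpre f ltn) t & size t = r.+1]) \/
  (exists t, [/\ subseq t s, sorted (relpre f gtn) t & size t = q.+1]).
Proof.
elim: r s => [|r IH] s us.
  by case: s us => // x s _ _; left; exists [:: x]; split=> //; rewrite sub1seq mem_head.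
move=> rq; case: (ltnP q (size (right_maxima s))) => [qs | sq].
  right; exists (take q.+1 (right_maxima s)); split; last by rewrite size_takel.
    exact: subseq_trans (take_subseq _ _) (right_maxima_subseq s).
  exact/take_sorted/right_maxima_sorted.
have us' : uniq (map f (non_right_maxima s)).
  exact: subseq_uniq (map_subseq _ (non_right_maxima_subseq s)) us.
case: (IH _ us'); first by have := size_right_maxima s; lia.
  case=> [[|x t] [st sort_t size_t]] //.
  have [y xy sty] := non_right_maxima_extend us st.
  left; exists (rcons (x :: t) y); split; rewrite ?size_rcons ?size_t //.
  by rewrite /= rcons_path /= xy andbT.
case=> t [st sort_t size_t]; right; exists t; split=> //.
exact: subseq_trans st (non_right_maxima_subseq s).
Qed.

End ErdosSzekeres.

(** * Zigzags between two arms *)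

Section Links.
Variables (T : eqType) (e : rel T).
Hypothesis esym : symmetric e.

(* [(a, m, b)] is the path from [a] to [b] with inner vertices [m]. *)
Definition link : Type := T * seq T * T.
Implicit Types (l : link) (L : seq link).

Definition is_link l := path e l.1.1 (rcons l.1.2 l.2).
Definition sources L := [seq l.1.1 | l <- L].
Definition targets L := [seq l.2 | l <- L].
Definition inner L := flatten [seq l.1.2 | l <- L].

Lemma path_rev x s z : path e x (rcons s z) -> path e z (rcons (rev s) x).
Proof.
move=> xs; rewrite -rev_cons -(belast_rcons x s z).
rewrite -[z in path _ z](last_rcons x s z) rev_path.
by rewrite (eq_path (e' := e)) // => u v; rewrite /= esym.
Qed.

Lemma sorted_rev s : sorted e (rev s) = sorted e s.
Proof. by rewrite rev_sorted; apply: eq_sorted => u v; rewrite esym. Qed.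

Lemma sorted_cat_cons s a t :
  sorted e (s ++ a :: t) = sorted e (rcons s a) && path e a t.
Proof. by case: s => [|x s] //=; rewrite -cat_rcons cat_path last_rcons. Qed.

(** Lets an arm be replaced by a walk with the same first vertex; [ohead] also covers the empty
    arm. *)
Lemma path_ohead x s t : path e x s -> sorted e t -> ohead t = ohead s -> path e x t.
Proof. by case: s t => [|u s] [|v t] //= /andP[xu _] -> [->]; rewrite xu. Qed.

(* Both walks switch arms at every link, so between them they traverse both
   arms entirely and every link twice. *)
Lemma zigzag L U W : sorted e U -> sorted e W -> all is_link L ->
  subseq (sources L) U -> subseq (targets L) W ->
  exists Z1 Z2,
    [/\ [/\ sorted e Z1, sorted e Z2, ohead Z1 = ohead U & ohead Z2 = ohead W],
        forall x y, last x Z1 = (if odd (size L) then last y W else last x U) /\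
                    last y Z2 = (if odd (size L) then last x U else last y W),
        msub Z1 (U ++ W ++ inner L), msub Z2 (U ++ W ++ inner L) &
        size U + size W + (size L).*2 <= size Z1 + size Z2].
Proof.
elim: L U W => [|[[a m] b] L IH] U W sU sW.
  move=> _ _ _; exists U, W; split=> // [z|z|]; rewrite /inner /= ?cats0 ?count_cat; lia.
move=> /andP[ab allL] /subseq_cons_split[U0 [U1 [defU subU]]].
move=> /subseq_cons_split[W0 [W1 [defW subW]]]; subst U W.
move: sU sW; rewrite !sorted_cat_cons => /andP[U0a aU1] /andP[W0b bW1].
have [Z1 [Z2 [[sZ1 sZ2 h1 h2] lasts c1 c2 sz]]] :=
  IH U1 W1 (path_sorted aU1) (path_sorted bW1) allL subU subW.
have [l1 l2] := lasts a b.
(* Each walk crosses the first link and goes on with the inductive walk that starts on the opposite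
   arm. *)
exists (U0 ++ a :: m ++ b :: Z2), (W0 ++ b :: rev m ++ a :: Z1); split.
- rewrite !sorted_cat_cons U0a W0b -!cat_rcons !cat_path !last_rcons.
  rewrite (path_ohead aU1 sZ1 h1) (path_ohead bW1 sZ2 h2) (ab : path e a (rcons m b)) (path_rev ab).
  by split=> //; [case: (U0) | case: (W0)].
- by move=> x y; rewrite !last_cat /= !last_cat /= l1 l2; case: (odd _).
- move=> z; move: (c1 z) (c2 z).
  by rewrite /inner /= !(count_cat, count_rev) /= !count_cat /=; clear; lia.
- move=> z; move: (c1 z) (c2 z).
  by rewrite /inner /= !(count_cat, count_rev) /= !(count_cat, count_rev) /=; clear; lia.
- by move: sz; rewrite /= !size_cat /= !size_cat /= size_rev; clear; lia.
Qed.

(** Decreasing links increase along [rev W], but the second walk then starts at the far end of [W].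
    With an even number of links it ends at the near end, so its reversal starts as [W] does. *)
Lemma zigzag_rev L U W : sorted e U -> sorted e W -> all is_link L ->
  ~~ odd (size L) -> subseq (sources L) U -> subseq (targets L) (rev W) ->
  exists Z1 Z2,
    [/\ [/\ sorted e Z1, sorted e Z2, ohead Z1 = ohead U & ohead Z2 = ohead W],
        msub Z1 (U ++ W ++ inner L), msub Z2 (U ++ W ++ inner L) &
        size U + size W + (size L).*2 <= size Z1 + size Z2].
Proof.
move=> sU sW allL evenL subU subW; rewrite -sorted_rev in sW.
have [Z1 [Z2 [[sZ1 sZ2 h1 h2] lasts c1 c2 sz]]] := zigzag sU sW allL subU subW.
exists Z1, (rev Z2); split.
- split; rewrite ?sorted_rev //.
  case: W Z2 h2 lasts {sW subW sZ2 c1 c2 sz} => [|w W] Z2 /=; first by case: Z2.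
  case/lastP: Z2 => [|Z2 z]; first by rewrite rev_cons; case: (rev W).
  move=> _ /(_ w w)[_]; rewrite (negPf evenL) rev_cons !last_rcons => ->.
  by rewrite rev_rcons.
- by move=> z; move: (c1 z); rewrite !(count_cat, count_rev).
- by move=> z; move: (c2 z); rewrite !(count_cat, count_rev).
- by move: sz; rewrite !size_rev.
Qed.

(* More than [cap m] links contain [m.+1] increasing ones or an even number, at
   least [m.+1], of decreasing ones; decreasing links only help in even number. *)
Definition cap m := if odd m then m * m else m * m.+1.

(** Superadditivity lets the gains of two quadrants add up when their walks are joined into one
    path. *)
Lemma cap_leq_add m1 m2 : cap m1 + cap m2 <= cap (m1 + m2).
Proof.
rewrite /cap oddD; case: (boolP (odd m1)) => o1; case: (boolP (odd m2)) => o2 /=; try nia.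
- have : 0 < m1 by case: m1 o1.
  nia.
- have : 0 < m2 by case: m2 o2.
  nia.
Qed.

Lemma cap_leq m1 m2 : m1 <= m2 -> cap m1 <= cap m2.
Proof. by move/subnKC <-; apply: leq_trans (cap_leq_add _ _); apply: leq_addr. Qed.

Lemma inner_subseq L L' : subseq L' L -> msub (inner L') (inner L).
Proof.
elim: L L' => [|l L IH] [|l' L'] //=.
case: eqP => [-> | _] /IH sub z; move: (sub z); rewrite /inner /= !count_cat; clear; lia.
Qed.

Lemma targets_subseq L W : uniq W -> {subset targets L <= W} ->
  sorted (relpre (fun l => index l.2 W) ltn) L -> subseq (targets L) W.
Proof. by move=> uW LW sL; apply: sorted_index_subseq => //; rewrite sorted_map. Qed.

Lemma targets_subseq_rev L W : uniq W -> {subset targets L <= W} ->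
  sorted (relpre (fun l => index l.2 W) gtn) L -> subseq (targets L) (rev W).
Proof.
move=> uW LW sL; rewrite -[targets L]revK subseq_rev -map_rev.
apply: targets_subseq => //; last by rewrite rev_sorted.
by move=> z; rewrite /targets map_rev mem_rev; apply: LW.
Qed.

Lemma inner_perm L L' : perm_eq L' L -> msub (inner L') (inner L).
Proof.
move=> pL z; have /permP -> // := perm_flatten (perm_map (fun l => l.1.2) pL).
Qed.

Lemma sources_sort L U : uniq U -> uniq (sources L) -> {subset sources L <= U} ->
  exists2 L', perm_eq L' L & subseq (sources L') U.
Proof.
move=> uU uL LU; pose key l := index l.1.1 U; pose L' := sort (relpre key leq) L.
have pL : perm_eq L' L by apply/permPl/perm_sort.
exists L' => //; apply: sorted_index_subseq => //.
  by move=> z; rewrite (perm_mem (perm_map _ pL)); apply: LU.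
have sL : sorted leq (map key L').
  by rewrite sorted_map; apply: sort_sorted => l l' /=; apply: leq_total.
have : sorted ltn (map key L').
  rewrite ltn_sorted_uniq_leq sL andbT (perm_uniq (perm_map _ pL)).
  rewrite (map_comp (index^~ U) (fun l => l.1.1)) map_inj_in_uniq //.
  by move=> a b /LU aU /LU bU /(congr1 (nth a U)); rewrite !nth_index.
by rewrite [in X in X -> _](map_comp (index^~ U) (fun l => l.1.1)) sorted_map.
Qed.

(** The gain [m] is the least one with [size L <= cap m]; if it is positive, the links exceed
    [cap m.-1] and Erdős-Szekeres applies. The longer of the two zigzags is kept, and it may start
    on either arm, whence the alternative for [z]. *)
Lemma quadrant L x U y W : path e x U -> path e y W -> all is_link L ->
  uniq U -> uniq W -> uniq (sources L) -> uniq (targets L) ->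
  {subset sources L <= U} -> {subset targets L <= W} ->
  exists m Z z,
    [/\ size L <= cap m, z = x \/ z = y, path e z Z, msub Z (U ++ W ++ inner L) &
        uphalf (size U + size W) + m <= size Z].
Proof.
move=> pU pW allL uU uW uS uD LU LW.
have longest n L' Z1 Z2 : size L <= cap n -> msub (inner L') (inner L) ->
    [/\ sorted e Z1, sorted e Z2, ohead Z1 = ohead U & ohead Z2 = ohead W] ->
    msub Z1 (U ++ W ++ inner L') -> msub Z2 (U ++ W ++ inner L') ->
    size U + size W + n.*2 <= size Z1 + size Z2 ->
  exists m Z z, [/\ size L <= cap m, z = x \/ z = y, path e z Z,
    msub Z (U ++ W ++ inner L) & uphalf (size U + size W) + m <= size Z].
  move=> capn subL [sZ1 sZ2 h1 h2] c1 c2 sz; exists n.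
  have widen Z : msub Z (U ++ W ++ inner L') -> msub Z (U ++ W ++ inner L).
    move=> cZ z; move: (cZ z) (subL z).
    by rewrite !count_cat; clear; lia.
  case: (leqP (size Z1) (size Z2)) => Z12.
    exists Z2, y; split; [by []|by right|exact: path_ohead h2|exact: widen|].
    by move: sz Z12; clear; lia.
  exists Z1, x; split; [by []|by left|exact: path_ohead h1|exact: widen|].
  by move: sz Z12; clear; lia.
have [n capn minn] : exists2 n, size L <= cap n & forall i, i < n -> cap i < size L.
  have ex : exists n, size L <= cap n.
    by exists (size L); rewrite /cap; case: ifP => _; nia.
  case: (ex_minnP ex) => n capn minn; exists n => // i.
  by rewrite !ltnNge; apply: contra; apply: minn.
have sU := path_sorted pU; have sW := path_sorted pW.
case: n capn minn => [|n] capn minn.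
  apply: (longest 0 L U W) => // [z|z|]; rewrite ?count_cat; clear; lia.
have {minn}capn' := minn n (leqnn _).
have [LS pL subLS] := sources_sort uU uS LU.
have sub_link t : subseq t LS ->
    [/\ all is_link t, subseq (sources t) U, {subset targets t <= W} &
        msub (inner t) (inner L)].
  move=> st; split.
  - by apply/allP => l /(mem_subseq st); rewrite (perm_mem pL); apply: (allP allL).
  - exact: subseq_trans (map_subseq _ st) subLS.
  - by move=> z /(mem_subseq (map_subseq _ st)); rewrite (perm_mem (perm_map _ pL)); apply: LW.
  - by move=> z; apply: leq_trans (inner_subseq st z) (inner_perm pL z).
have uf : uniq (map (fun l => index l.2 W) LS).
  rewrite (perm_uniq (perm_map _ pL)) (map_comp (index^~ W) (fun l => l.2)).
  rewrite map_inj_in_uniq // => a b /LW aW /LW bW /(congr1 (nth a W)).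
  by rewrite !nth_index.
(* [q] is the odd one of [n] and [n.+1]: then [n * q] is [cap n], and [q.+1] decreasing links are
   even in number. *)
pose q := if odd n then n else n.+1.
have ES : n * q < size LS.
  by rewrite (perm_size pL) /q; move: capn'; rewrite /cap; case: ifP.
have [[t [st sort_t size_t]]|[t [st sort_t size_t]]] := erdos_szekeres uf ES;
  have [allt subU tW subI] := sub_link _ st.
  have [Z1 [Z2 [h _ c1 c2 sz]]] := zigzag sU sW allt subU (targets_subseq uW tW sort_t).
  by apply: (longest n.+1 t Z1 Z2) => //; rewrite -size_t.
have even_t : ~~ odd (size t) by rewrite size_t /q; case: ifP => //= ->.
have [Z1 [Z2 [h c1 c2 sz]]] :=
  zigzag_rev sU sW allt even_t subU (targets_subseq_rev uW tW sort_t).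
apply: (longest n.+1 t Z1 Z2) => //; apply: leq_trans sz.
by rewrite size_t /q; case: (odd n); clear; lia.
Qed.

End Links.

(** * Menger's theorem *)

Section Menger.
Variable T : finType.
Implicit Types (e : rel T) (A B S : {set T}) (s : seq T).

Definition ab_path e A B s :=
  if s is x :: t then [&& x \in A, path e x t & last x t \in B] else false.

(** The A-B paths of Menger's theorem; the conditions on the ends later keep the interior of every
    link off both long paths. *)
Definition clean_path e A B s :=
  if s is x :: t then
    [&& ab_path e A B s, uniq s, ~~ has (mem A) t & ~~ has (mem B) (belast x t)]
  else false.

Definition separates e A B S := forall s, ab_path e A B s -> has (mem S) s.

Definition linked e A B k := exists f : 'I_k -> seq T,
  (forall i, clean_path e A B (f i)) /\
  (forall i j z, z \in f i -> z \in f j -> i = j).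

Lemma clean_path_ab e A B s : clean_path e A B s -> ab_path e A B s.
Proof. by case: s => // x s /and4P[]. Qed.

Lemma clean_path_uniq e A B s : clean_path e A B s -> uniq s.
Proof. by case: s => // x s /and4P[]. Qed.

Lemma clean_path_head e A B s z w :
  clean_path e A B s -> z \in s -> z \in A -> z = head w s.
Proof.
case: s => // x s /and4P[_ _ /hasPn sA _].
by rewrite in_cons => /orP[/eqP // | /sA /= /negPf ->].
Qed.

Lemma clean_path_last e A B s z w :
  clean_path e A B s -> z \in s -> z \in B -> z = last w s.
Proof.
case: s => // x s /and4P[_ _ _ /hasPn sB] zs zB; move: zs.
by rewrite lastI mem_rcons in_cons last_rcons => /orP[/eqP // | /sB /=]; rewrite zB.
Qed.

Lemma ab_path_cat e A B s z t : ab_path e A B (s ++ z :: t) =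
  ab_path e A [set z] (rcons s z) && ab_path e [set z] B (z :: t).
Proof.
case: s => [|x s] /=; rewrite ?last_rcons set11 /= ?andbT //.
by rewrite rcons_path cat_path last_cat /= !andbA.
Qed.

Lemma ab_path_retarget e A B B' s z :
  ab_path e A B (rcons s z) -> z \in B' -> ab_path e A B' (rcons s z).
Proof.
case: s => [|u s] /= + zB; rewrite ?last_rcons zB; first by case/andP=> ->.
by case/and3P=> -> ->.
Qed.

(** After removing repetitions, restart at a later vertex of [A] or stop at an earlier vertex of
    [B]; each such cut shortens the path. *)
Lemma clean_path_exists e A B s : ab_path e A B s ->
  exists2 t, clean_path e A B t & {subset t <= s}.
Proof.
case: s => // x s /and3P[xA xs sB].
case: (shortenP xs) sB => {xs}s' xs' us' sub sB.
have sub' : {subset x :: s' <= x :: s}.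
  by move=> z; rewrite !inE => /orP[->|/sub ->]; rewrite ?orbT.
suff [t ct tx] : exists2 t, clean_path e A B t & {subset t <= x :: s'}.
  by exists t => // z /tx /sub'.
have : ab_path e A B (x :: s') by rewrite /= xA xs'.
move: (x :: s') us' => {sub sub' x s xA s' xs' sB} s us.
have [n] := ubnP (size s); elim: n s us => // n IH [//|x s] us size_s ab_s.
case: (boolP (has (mem A) s)) => [/hasP[z zs /= zA] | noA].
  case/splitPr: zs us size_s ab_s => s1 s2 us size_s ab_s.
  have [||//|t ct ts] := IH (z :: s2).
  - by move: us; rewrite -cat_cons cat_uniq => /and3P[].
  - by move: size_s; rewrite /= size_cat /=; clear; lia.
  - by move: ab_s; rewrite -cat_cons ab_path_cat /= zA => /and3P[_ _ /andP[-> ->]].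
  by exists t => // w /ts; rewrite -cat_cons mem_cat => ->; rewrite orbT.
case: (boolP (has (mem B) (belast x s))) => [/hasP[z zs /= zB] | noB].
  case/lastP: s zs us size_s ab_s noA => // s y; rewrite belast_rcons => zs.
  rewrite -rcons_cons.
  move: (x :: s) zs => _ /splitPr[s1 s2] us size_s ab_s noA.
  have [||//|t ct ts] := IH (rcons s1 z).
  - move: us; rewrite -cat_rcons rcons_cat cat_uniq => /andP[] //.
  - by move: size_s; rewrite !size_rcons !size_cat /=; clear; lia.
  - move: ab_s; rewrite rcons_cat rcons_cons ab_path_cat => /andP[+ _].
    by move/ab_path_retarget; apply.
  exists t => // w /ts; rewrite rcons_cat rcons_cons mem_cat mem_rcons !inE.
  by case/orP => ->; rewrite ?orbT.
by exists (x :: s) => //; rewrite /clean_path ab_s us noA noB.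
Qed.

Lemma linked_of_walks e A B k (f : 'I_k -> seq T) :
  (forall i, ab_path e A B (f i)) ->
  (forall i j z, z \in f i -> z \in f j -> i = j) -> linked e A B k.
Proof.
move=> fP fD.
have /fin_all_exists2[g gP gf] : forall i, exists2 t, clean_path e A B t & {subset t <= f i}.
  by move=> i; apply: clean_path_exists.
by exists g; split=> // i j z /gf zi /gf; apply: fD zi.
Qed.

(** Only the direction from [x] to [y] is deleted: [e] is treated as a digraph. *)
Definition del_arc e x y : rel T := [rel a b | e a b && ~~ ((a == x) && (b == y))].

(** The arc is used only on leaving [x], which here can only be the final vertex. *)
Lemma ab_path_del_src e x y A B s z : ab_path e A B (rcons s z) -> x \notin s ->
  ab_path (del_arc e x y) A B (rcons s z).
Proof.
case: s => [|u s] //=; rewrite !last_rcons => /and3P[-> + ->]; rewrite andbT /=.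
elim: s u => [|v s IH] u /=; rewrite !inE {1}/del_arc /= ?andbT ?negb_or.
  by move=> ->; rewrite eq_sym => /negPf ->.
by case/andP=> -> /IH {}IH /and3P[xu xv xs]; rewrite eq_sym (negPf xu) IH // !inE negb_or xv.
Qed.

Lemma ab_path_del_dst e x y A B z s : ab_path e A B (z :: s) -> y \notin s ->
  ab_path (del_arc e x y) A B (z :: s).
Proof.
rewrite /= => /and3P[-> + ->]; rewrite andbT /=.
elim: s z => [|v s IH] u //=; rewrite !inE {1}/del_arc /= ?negb_or.
by case/andP=> -> /IH {}IH /andP[xv xs]; rewrite eq_sym [v == y]eq_sym (negPf xv) andbF IH.
Qed.

Lemma ab_path_sub e e' A B s : subrel e e' -> ab_path e A B s -> ab_path e' A B s.
Proof. by case: s => //= x s ee' /and3P[-> /(sub_path ee') -> ->]. Qed.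

Lemma separates_del_src e x y A B S :
  separates (del_arc e x y) A B S -> separates e A B (x |: S).
Proof.
move=> sepS s ab_s; case: (boolP (x \in s)) => [xs | xs].
  by apply/hasP; exists x => //=; rewrite setU11.
suff /sepS /hasP[z zs /= zS] : ab_path (del_arc e x y) A B s.
  by apply/hasP; exists z => //=; rewrite setU1r.
case/lastP: s ab_s xs => // s z ab_s.
by rewrite mem_rcons inE negb_or => /andP[_ xs]; apply: ab_path_del_src.
Qed.

Lemma separates_del_dst e x y A B S :
  separates (del_arc e x y) A B S -> separates e A B (y |: S).
Proof.
move=> sepS s ab_s; case: (boolP (y \in s)) => [ys | ys].
  by apply/hasP; exists y => //=; rewrite setU11.
suff /sepS /hasP[z zs /= zS] : ab_path (del_arc e x y) A B s.
  by apply/hasP; exists z => //=; rewrite setU1r.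
case: s ab_s ys => // z s ab_s.
by rewrite inE negb_or => /andP[_ ys]; apply: ab_path_del_dst.
Qed.

(** The segment up to the first vertex in [x |: S] can contain [x] only as its end, so it avoids the
    arc and is met by [S']. *)
Lemma separates_first e x y A B S S' : separates e A B (x |: S) ->
  separates (del_arc e x y) A (x |: S) S' -> separates e A B S'.
Proof.
move=> sepS sepS' s ab_s; have hs := sepS s ab_s.
case/split_find: hs ab_s => z s1 s2 zS noS; rewrite cat_rcons ab_path_cat => /andP[ab1 _].
have {}ab1 : ab_path e A (x |: S) (rcons s1 z).
  exact: ab_path_retarget ab1 zS.
have /sepS' : ab_path (del_arc e x y) A (x |: S) (rcons s1 z).
  apply: ab_path_del_src => //; apply/negP => xs1; case/hasP: noS.
  by exists x => //=; rewrite setU11.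
by rewrite -cat_rcons has_cat => ->.
Qed.

Lemma separates_last e x y A B S S' : separates e A B (y |: S) ->
  separates (del_arc e x y) (y |: S) B S' -> separates e A B S'.
Proof.
move=> sepS sepS' s ab_s; have := sepS s ab_s; move: ab_s.
(* Reversal turns the last visit to [y |: S] into a first one. *)
rewrite -[s]revK; move: (rev s) => r; rewrite !has_rev => + hr.
case/split_find: hr => z s1 s2 zS noS.
rewrite rev_cat rev_rcons ab_path_cat => /andP[_ ab1].
have {}ab1 : ab_path e (y |: S) B (z :: rev s1).
  by move: ab1 => /= /and3P[_ -> ->]; rewrite (zS : z \in y |: S).
have /sepS' : ab_path (del_arc e x y) (y |: S) B (z :: rev s1).
  apply: ab_path_del_dst => //; rewrite mem_rev; apply/negP => ys1; case/hasP: noS.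
  by exists y => //=; rewrite setU11.
by rewrite has_cat has_rcons /= has_rev => ->.
Qed.


(** Following [s] up to [z] and then [t] gives an A-B walk, which [S] must hit. As [s] can meet [S]
    only at its end and [t] only at its start, it is hit at [z]. *)
Lemma clean_path_meet e A B S (C D : {set T}) s t (z w : T) : separates e A B S -> S \subset C -> S \subset D ->
  clean_path e A C s -> clean_path e D B t -> z \in s -> z \in t ->
  [/\ z \in S, z = last w s & z = head w t].
Proof.
move=> sepS /subsetP SC /subsetP SD cs ct zs zt.
suff zS : z \in S.
  by split=> //; [apply: clean_path_last cs zs (SC _ zS) | apply: clean_path_head ct zt (SD _ zS)].
have us := clean_path_uniq cs; have ut := clean_path_uniq ct.
have lastS u : u \in s -> u \in S -> u = last w s.
  by move=> us' uS; apply: clean_path_last cs us' (SC _ uS).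
have headS u : u \in t -> u \in S -> u = head w t.
  by move=> ut' uS; apply: clean_path_head ct ut' (SD _ uS).
move: (clean_path_ab cs) (clean_path_ab ct) us ut lastS headS; clear cs ct.
case/splitPr: zs => s1 s2; case/splitPr: zt => t1 t2; rewrite !ab_path_cat.
move=> /andP[ab1 _] /andP[_ ab2] us ut lastS headS.
have /sepS /hasP[u + /= uS] : ab_path e A B (s1 ++ z :: t2).
  rewrite ab_path_cat ab1 /=; move: ab2 => /=.
  by rewrite !inE eqxx.
rewrite mem_cat inE => /or3P[us1|/eqP <- //|ut2].
  have ul := lastS u; rewrite mem_cat us1 /= last_cat /= in ul.
  move: us; rewrite cat_uniq => /and3P[_ /hasPn /(_ (last z s2))].
  by rewrite mem_last -(ul isT uS) /= us1 => /(_ isT).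
have uh := headS u; rewrite mem_cat inE ut2 !orbT in uh.
move: ut; rewrite cat_uniq /= negb_or -!andbA => /and5P[_ zt1 /hasPn disj zt2 _].
case: t1 zt1 disj {headS} uh => [|v t1] /= _ disj uh.
  by rewrite -(uh isT uS) ut2 in zt2.
by have := disj u ut2; rewrite /= (uh isT uS) inE eqxx.
Qed.

Lemma inj_onto_card k (D : {set T}) (g : 'I_k -> T) : injective g ->
  (forall i, g i \in D) -> #|D| <= k -> forall z, z \in D -> exists i, g i = z.
Proof.
move=> gI gD Dk z zD.
have sub : g @: setT \subset D by apply/subsetP => _ /imsetP[i _ ->].
have : g @: setT == D by rewrite eqEcard sub card_imset // cardsT card_ord.
by move/eqP=> defD; move: zD; rewrite -defD => /imsetP[i _ ->]; exists i.
Qed.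

(* Goering's induction: when deleting the arc [x -> y] leaves a separator [S]
   of size [k.-1], both [x |: S] and [y |: S] are separators of size [k], and
   the linkages towards the first and from the second meet only in [S]. *)
Theorem menger e A B k : irreflexive e ->
  (forall S, separates e A B S -> k <= #|S|) -> linked e A B k.
Proof.
have [n] := ubnP #|[set p : T * T | e p.1 p.2]|; elim: n e A B => // n IH e A B size_e irr sepk.
case: (set_0Vmem [set p : T * T | e p.1 p.2]) => [e0 | [[x y]]].
  (* Without arcs every A-B walk is a single vertex of [A :&: B], so this set is itself a
     separator. *)
  have no_arc x y : e x y = false.
    by apply: contraFF (in_set0 (x, y)); rewrite -e0 inE.
  have kAB : k <= #|A :&: B|.
    apply: sepk => -[|x [|y s]] //=; last by rewrite no_arc andbF.
    by rewrite inE orbF => /andP[-> ->].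
  have kAB' : size (enum (A :&: B)) >= k by rewrite -cardE.
  case: k {IH sepk} kAB kAB' => [|k] kAB kAB'.
    by exists (fun i => [::]); split=> // [] [].
  have /card_gt0P[x0 _] : 0 < #|A :&: B| by apply: leq_trans kAB.
  apply: (linked_of_walks (f := fun i => [:: nth x0 (enum (A :&: B)) i])) => [i | i j z].
    have : nth x0 (enum (A :&: B)) i \in A :&: B.
      by rewrite -mem_enum mem_nth // (leq_trans (ltn_ord i)).
    by rewrite inE /= => /andP[-> ->].
  rewrite !inE => /eqP -> /eqP /(congr1 (index^~ (enum (A :&: B)))).
  rewrite !index_uniq ?enum_uniq ?(leq_trans (ltn_ord _)) //.
  exact: ord_inj.
rewrite inE /= => exy; set e' := del_arc e x y.
have sub_e : subrel e' e by move=> u v /andP[].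
have irr' : irreflexive e' by move=> u; rewrite /e' /del_arc /= irr.
have size_e' : #|[set p : T * T | e' p.1 p.2]| < n.
  rewrite ltnS in size_e; apply: leq_trans size_e; apply: proper_card; apply/properP; split.
    by apply/subsetP => p; rewrite !inE => /sub_e.
  by exists (x, y); rewrite !inE // /e' /del_arc /= !eqxx andbF.
have [sepk' | ] := classic (forall S, separates e' A B S -> k <= #|S|).
  have [f [fP fD]] := IH e' A B size_e' irr' sepk'.
  apply: (linked_of_walks (f := f)) fD => i.
  exact: ab_path_sub sub_e (clean_path_ab (fP i)).
move=> nall; have [S nS] := not_all_ex_not _ _ nall.
have [sepS /negP] := imply_to_and _ _ nS; rewrite -ltnNge => Sk.
have sepx := separates_del_src sepS; have sepy := separates_del_dst sepS.
have card_S z : separates e A B (z |: S) -> #|z |: S| = k /\ z \notin S.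
  by move=> /sepk; rewrite cardsU1; case: (z \in S) => /= kS; split=> //; move: kS Sk; clear; lia.
have [cardx xS] := card_S x sepx; have [cardy yS] := card_S y sepy.
have [P [cP disjP]] := IH e' A (x |: S) size_e' irr' (fun S' h => sepk S' (separates_first sepx h)).
have [Q [cQ disjQ]] := IH e' (y |: S) B size_e' irr' (fun S' h => sepk S' (separates_last sepy h)).
pose tgt i := last x (P i); pose src j := head y (Q j).
have tgtP i : (tgt i \in x |: S) * (tgt i \in P i).
  by move: (clean_path_ab (cP i)); rewrite /tgt; case: (P i) => //= u s /and3P[_ _ ->]; rewrite mem_last.
have srcP j : (src j \in y |: S) * (src j \in Q j).
  by move: (clean_path_ab (cQ j)); rewrite /src; case: (Q j) => //= u s /and3P[-> _ _]; rewrite mem_head.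
have src_inj : injective src.
  by move=> i j ij; apply: (disjQ i j (src i)); rewrite ?srcP // ij srcP.
have src_onto := inj_onto_card src_inj (fun j => (srcP j).1) (eq_leq cardy).
(* A path ending at [x] crosses the deleted arc to [y]; any other ends in [S] and is continued from
   the same vertex, which [R] then drops to avoid repeating it. *)
pose nxt i := if tgt i == x then y else tgt i.
have nxtS i : nxt i \in y |: S.
  rewrite /nxt; case: eqP => [_ | /eqP tx]; first exact: setU11.
  by have := (tgtP i).1; rewrite !inE (negPf tx) => /= ->; rewrite orbT.
have nxt_inj i j : nxt i = nxt j -> i = j.
  move=> eq_n; suff eq_t : tgt i = tgt j by apply: (disjP i j (tgt i)); rewrite ?tgtP // eq_t tgtP.
  move: eq_n (tgtP i).1 (tgtP j).1; rewrite /nxt !inE.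
  case: (eqVneq (tgt i) x) => [ti | ti]; case: (eqVneq (tgt j) x) => [tj | tj] //= eq_n.
  - by rewrite ti tj.
  - by move=> _; rewrite -eq_n (negPf yS).
  - by rewrite eq_n (negPf yS).
have /fin_all_exists[J JP] : forall i, exists j, src j = nxt i.
  by move=> i; apply: src_onto.
pose R i := if tgt i == x then Q (J i) else behead (Q (J i)).
have RQ i : {subset R i <= Q (J i)} by rewrite /R; case: ifP => // _; case: (Q _) => //= u t z; rewrite inE orbC => ->.
have meetPQ i j z w : z \in P i -> z \in Q j ->
    [/\ z \in S, z = last w (P i) & z = head w (Q j)].
  exact: clean_path_meet sepS (subsetU1 _ _) (subsetU1 _ _) (cP i) (cQ j).
(* A shared vertex lies in [S], ends the first path and starts the second, so the two were joined to
   each other. *)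
have cross i j z : z \in P i -> z \in R j -> i = j.
  move=> zi zj; have [zS ti sj] := meetPQ _ _ _ x zi (RQ _ _ zj).
  apply: nxt_inj; rewrite -(JP j).
  have -> : src (J j) = z by have [_ _ ->] := meetPQ _ _ _ y zi (RQ _ _ zj).
  rewrite /nxt /tgt -ti; case: eqP => // zx; by rewrite -zx zS in xS.
apply: (linked_of_walks (f := fun i => P i ++ R i)) => [i | i j z].
  have := clean_path_ab (cQ (J i)); have := clean_path_ab (cP i).
  have := JP i; rewrite /src /nxt /R /tgt.
  case: (P i) => // u s; case: (Q (J i)) => // v t /=.
  move=> vE /and3P[uA /(sub_path sub_e) us sS] /and3P[vS /(sub_path sub_e) vt tB].
  rewrite uA cat_path last_cat us /=; case: eqP vE => [-> vy /= | _ <-].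
    by rewrite vt tB vy exy.
  by rewrite vt tB.
rewrite !mem_cat => /orP[zi | zi] /orP[zj | zj].
- exact: disjP zi zj.
- exact: cross zi zj.
- by apply/esym; apply: cross zj zi.
- apply: nxt_inj; rewrite -!JP; congr src.
  exact: disjQ (RQ _ _ zi) (RQ _ _ zj).
Qed.

End Menger.

(** * Two paths crossing at a hub *)

Section Crossing.
Variables (T : finType) (e : rel T).
Hypothesis esym : symmetric e.
Implicit Types (L : seq (link T)) (U W : seq T).

Definition links_between L U W :=
  [/\ all (is_link e) L, uniq (sources L), uniq (targets L),
      {subset sources L <= U} & {subset targets L <= W}].

Lemma links_between_filter (P : pred (link T)) L U W U' W' : links_between L U W ->
  (forall l, P l -> l.1.1 \in U -> l.1.1 \in U') ->
  (forall l, P l -> l.2 \in W -> l.2 \in W') ->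
  links_between (filter P L) U' W'.
Proof.
move=> [aL uS uD LU LW] PU PW; have sub := filter_subseq P L; split.
- by rewrite all_filter; apply/allP => l /(allP aL) /= ->; rewrite implybT.
- exact: subseq_uniq (map_subseq _ sub) uS.
- exact: subseq_uniq (map_subseq _ sub) uD.
- move=> _ /mapP[l + ->]; rewrite mem_filter => /andP[Pl lL].
  by apply: PU => //; apply: LU; apply: (map_f (fun l => l.1.1)).
- move=> _ /mapP[l + ->]; rewrite mem_filter => /andP[Pl lL].
  by apply: PW => //; apply: LW; apply: map_f.
Qed.

Lemma inner_filter (P Q : pred (link T)) L z : (forall l, P l -> ~~ Q l) ->
  count_mem z (inner (filter P L)) + count_mem z (inner (filter Q L)) <=
  count_mem z (inner L).
Proof.
move=> PQ; elim: L => //= l L; rewrite /inner /=.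
have := PQ l; case: (P l) => [/(_ isT) /negPf -> | _]; last case: (Q l);
  rewrite /= !count_cat; clear; lia.
Qed.

Lemma is_gpath_cat s z t : is_gpath e (s ++ z :: t) =
  sorted e (rcons s z) && path e z t && uniq (s ++ z :: t).
Proof. by rewrite -sorted_cat_cons; case: s. Qed.

(** Each quadrant walk may leave from either end of the hub path, so the connection is a single end,
    the hub path or its reverse. *)
Lemma hub_walk x h z1 z2 : path e x h ->
  z1 = x \/ z1 = last x h -> z2 = x \/ z2 = last x h ->
  exists c, [/\ path e z1 c, last z1 c = z2 & msub (z1 :: c) (x :: h)].
Proof.
have count_last z : count_mem z [:: last x h] <= count_mem z (x :: h).
  by rewrite (lastI x h) -cats1 count_cat leq_addl.
move=> xh [->|->] [->|->].
- by exists [::]; split=> // z /=; clear; lia.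
- by exists h; split=> // z.
- exists (rev (belast x h)); split.
  + by rewrite rev_path (eq_path (e' := e)) // => u w; rewrite /= esym.
  + by case: (h) => //= u h'; rewrite rev_cons last_rcons.
  + by move=> z; rewrite -rev_rcons -(lastI x h) count_rev.
- by exists [::]; split.
Qed.

(* The hub path [x :: h] plays the role of a single vertex from which the four
   arms [A1], [A2], [B1], [B2] emanate. *)
Lemma double_quadrant x h A1 A2 B1 B2 L1 L2 : path e x h ->
  path e x A1 -> path e x A2 -> path e (last x h) B1 -> path e (last x h) B2 ->
  links_between L1 A1 B1 -> links_between L2 A2 B2 ->
  uniq ((x :: h) ++ (A1 ++ B1 ++ inner L1) ++ (A2 ++ B2 ++ inner L2)) ->
  exists m s, [/\ is_gpath e s, size L1 + size L2 <= cap m &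
    uphalf (size A1 + size B1) + uphalf (size A2 + size B2) + m <= plength s].
Proof.
move=> xh xA1 xA2 yB1 yB2 [aL1 uS1 uD1 LU1 LW1] [aL2 uS2 uD2 LU2 LW2] uniq_all.
have sub_uniq s : msub s ((x :: h) ++ (A1 ++ B1 ++ inner L1) ++ (A2 ++ B2 ++ inner L2)) -> uniq s.
  by move=> ms; apply: msub_uniq ms uniq_all.
have [||m1 [Z1 [z1 [cap1 z1E p1 c1 size1]]]] :=
  quadrant esym xA1 yB1 aL1 _ _ uS1 uD1 LU1 LW1;
  try by apply: sub_uniq => z; rewrite !count_cat; clear; lia.
have [||m2 [Z2 [z2 [cap2 z2E p2 c2 size2]]]] :=
  quadrant esym xA2 yB2 aL2 _ _ uS2 uD2 LU2 LW2;
  try by apply: sub_uniq => z; rewrite !count_cat; clear; lia.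
have [c [pc lc cc]] := hub_walk xh z1E z2E.
exists (m1 + m2), (rev Z1 ++ z1 :: c ++ Z2); split.
- rewrite is_gpath_cat -rev_cons sorted_rev // cat_path pc lc p2 andbT /= p1 /=.
  apply: sub_uniq => z; move: (c1 z) (c2 z) (cc z).
  by rewrite !(count_cat, count_rev) /= !count_cat; clear; lia.
- exact: leq_trans (leq_add cap1 cap2) (cap_leq_add _ _).
- rewrite /plength !size_cat /= size_cat size_rev.
  rewrite addnS /= addnACA; apply: leq_trans (leq_add size1 size2) _.
  by rewrite leq_add2l leq_addl.
Qed.

(** Each link falls into one of four quadrants. Opposite quadrants use disjoint arms, so each of the
    two opposite pairs yields one path. *)
Lemma crossing x h A1 A2 B1 B2 L : path e x h ->
  path e x A1 -> path e x A2 -> path e (last x h) B1 -> path e (last x h) B2 ->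
  links_between L (A1 ++ A2) (B1 ++ B2) ->
  uniq ((x :: h) ++ (A1 ++ A2) ++ (B1 ++ B2) ++ inner L) ->
  exists m m' s s', [/\ is_gpath e s, is_gpath e s', size L <= cap m + cap m',
    uphalf (size A1 + size B1) + uphalf (size A2 + size B2) + m <= plength s &
    uphalf (size A1 + size B2) + uphalf (size A2 + size B1) + m' <= plength s'].
Proof.
move=> xh xA1 xA2 yB1 yB2 LL uniq_all.
pose F (b c : bool) (l : link T) := ((l.1.1 \in A1) == b) && ((l.2 \in B1) == c).
have LF b c : links_between (filter (F b c) L) (if b then A1 else A2) (if c then B1 else B2).
  apply: links_between_filter LL _ _ => l /andP[/eqP lA /eqP lB];
    rewrite mem_cat ?lA ?lB.
    by case: (b) lA.
  by case: (c) lB.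
have exF b c : forall l, F b c l -> ~~ F (~~ b) (~~ c) l.
  by move=> l /andP[/eqP lA _]; rewrite /F lA; case: (b).
have size_F : size L = size (filter (F true true) L) + size (filter (F false false) L) +
   (size (filter (F true false) L) + size (filter (F false true) L)).
  rewrite !size_filter; elim: (L) => //= l L' ->; rewrite /F.
  by case: (_ \in A1); case: (_ \in B1); rewrite /=; clear; lia.
have [|m [s [gs cap_s size_s]]] :=
  double_quadrant xh xA1 xA2 yB1 yB2 (LF true true) (LF false false).
  apply: msub_uniq uniq_all => z; move: (inner_filter L z (exF true true)).
  by rewrite !count_cat /=; clear; lia.
have [|m' [s' [gs' cap_s' size_s']]] :=
  double_quadrant xh xA1 xA2 yB2 yB1 (LF true false) (LF false true).
  apply: msub_uniq uniq_all => z; move: (inner_filter L z (exF true false)).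
  by rewrite !count_cat /=; clear; lia.
exists m, m', s, s'; split=> //; rewrite size_F; exact: leq_add.
Qed.

End Crossing.

(** Integer form of the choice of [t]: for odd [p], squaring [t - 1 < sqrt((k - 2) / 2)] gives
    [2 * t.-1 ^ 2 < k - 2]; for even [p] the bound is on [t] itself and equality is allowed. *)
Definition t_bound (k p t : nat) :=
  if odd p then 0 < t /\ 2 * t.-1 ^ 2 + 3 <= k else 2 * t ^ 2 + 2 <= k.

Lemma t_bound_double k p t : t_bound k p t -> t.*2 < k.+2.
Proof.
rewrite /t_bound; case: ifP => _; last by clear; nia.
by case: t => [|n] /= []; clear; nia.
Qed.

(** Averaging gives [m, m' < t], so [k.-1] is at most twice [cap t.-1]. This contradicts [t_bound],
    except possibly when [p] and [t] are odd, where parity saves one more unit. *)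
Lemma crossing_arith k p t a1 a2 b1 b2 m m' : t_bound k p t ->
  p + 1 <= a1 + a2 + t -> p + 1 <= b1 + b2 + t -> k.-1 <= cap m + cap m' ->
  uphalf (a1 + b1) + uphalf (a2 + b2) + m <= p ->
  uphalf (a1 + b2) + uphalf (a2 + b1) + m' <= p -> False.
Proof.
rewrite /t_bound => tb pa pb km mp mp'.
have m_t : m < t by move: pa pb mp; clear; lia.
have m_t' : m' < t by move: pa pb mp'; clear; lia.
have t_gt0 : t = t.-1.+1 by move: m_t; clear; lia.
have capm : cap m <= cap t.-1 by apply: cap_leq; move: m_t; clear; lia.
have capm' : cap m' <= cap t.-1 by apply: cap_leq; move: m_t'; clear; lia.
move: t t_gt0 tb pa pb m_t m_t' capm capm' => [//|t] _ /= tb pa pb m_t m_t' capm capm'.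
case: ifP tb => [odd_p [_ tb] | _ tb].
  (* [t] now stands for the parameter minus one. *)
  case: (boolP (odd t)) => odd_t.
    have capt : cap t = t * t by rewrite /cap odd_t.
    by move: tb km capm capm' capt; clear; nia.
  have capt : cap t = t * t.+1 by rewrite /cap (negPf odd_t).
  have capt1 : cap t.-1 <= t.-1 * t.
    by rewrite /cap; case: (t) => //= n; case: ifP => _; clear; nia.
  (* If both gains were [t], both lengths would equal [p - t], which is odd, and no half could be
     rounded up; but [a1 + b1] and [a1 + b2] would differ in parity. *)
  have min_m : m < t \/ m' < t.
    by move: odd_p odd_t pa pb mp mp' m_t m_t'; clear; lia.
  have small n : n < t -> cap n <= t.-1 * t.
    by move=> nt; apply: leq_trans capt1; apply: cap_leq; move: nt; clear; lia.
  have : t.-1 * t + t * t.+1 <= 2 * t ^ 2 by case: (t) => //= n; clear; nia.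
  by case: min_m => /small; move: tb km capm capm'; rewrite capt; clear; lia.
have capt : cap t <= t * t.+1 by rewrite /cap; case: ifP => _; nia.
by move: tb km capm capm' capt; clear; nia.
Qed.

Lemma uniq_flatten_map (I T : eqType) (g : I -> seq T) s : uniq s ->
  (forall i, i \in s -> uniq (g i)) ->
  (forall i j z, i \in s -> j \in s -> z \in g i -> z \in g j -> i = j) ->
  uniq (flatten (map g s)).
Proof.
elim: s => //= i s IH /andP[i_s us] ug disj; rewrite cat_uniq ug ?mem_head //=.
rewrite IH //; first last.
- by move=> j j' z js js'; apply: disj; rewrite inE ?js ?js' orbT.
- by move=> j js; apply: ug; rewrite inE js orbT.
rewrite andbT; apply/hasPn => z /flatten_mapP[j js zj]; apply: contra i_s => zi.
by rewrite (disj i j z) ?mem_head // inE js orbT.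
Qed.

(** * Choosing the hub and the links *)

Section HubAndLinks.
Variables (T : finType) (e : rel T) (k : nat).
Hypotheses (eirr : irreflexive e) (ekconn : k_connected e k).

(** Fewer than [k] vertices cover neither set and do not disconnect the rest, so every separator has
    at least [k]. *)
Lemma k_connected_linked (A B : {set T}) : k <= #|A| -> k <= #|B| -> linked e A B k.
Proof.
move=> kA kB; apply: menger => // S sepS; rewrite leqNgt; apply/negP => Sk.
have pick_outside (C : {set T}) : k <= #|C| -> exists2 z, z \in C & z \notin S.
  move=> kC; apply/exists_inP; rewrite -[X in is_true X]negbK negb_exists_in.
  apply/negP => /forall_inP CS; have /subset_leq_card : C \subset S.
    by apply/subsetP => z /CS; rewrite negbK.
  by rewrite leqNgt (leq_trans Sk kC).
have [a aA aS] := pick_outside A kA; have [b bB bS] := pick_outside B kB.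
have /connectP[s as_ bE] := ekconn.2 S Sk a b aS bS.
have /sepS : ab_path e A B (a :: s).
  by rewrite /= aA -bE bB andbT; apply: sub_path as_ => u w /and3P[].
rewrite /= (negPf aS) /=; apply/negP.
elim: s a as_ {aA aS bE} => //= u s IH a /andP[/and3P[_ _ uS] us].
by rewrite /= (negPf uS); apply: IH us.
Qed.

Lemma hub_and_links A B v : 0 < k -> is_gpath e A -> is_gpath e B ->
  (forall z, z \in A -> z \in B -> z = v) -> k <= size A -> k <= size B ->
  exists A1 x A2 B1 B2 h L,
    [/\ A = rev A1 ++ x :: A2 /\ B = rev B1 ++ last x h :: B2, path e x h,
        links_between e L (A1 ++ A2) (B1 ++ B2), size L = k.-1 &
        uniq ((x :: h) ++ (A1 ++ A2) ++ (B1 ++ B2) ++ inner L)].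
Proof.
move=> k_gt0 gA gB ABv kA kB.
have uniq_gpath s : is_gpath e s -> uniq s by case: s => // a s /andP[].
have uA := uniq_gpath A gA; have uB := uniq_gpath B gB.
pose SA := [set z in A]; pose SB := [set z in B].
have card_seq s : uniq s -> #|[set z in s]| = size s by move=> us; rewrite cardsE (card_uniqP us).
have [f [cf df]] : linked e SA SB k by apply: k_connected_linked; rewrite card_seq.
(* The hub is a Menger path through [v] if there is one, else the trivial path at [v] if [v] is
   common, else any Menger path. In each case one Menger path is given up. *)
have [i0 [h0 [ch0 vh0 dh0]]] : exists i0 h0, [/\ clean_path e SA SB h0,
    v \in A -> v \in B -> v \in h0 & forall i z, i != i0 -> z \in f i -> z \notin h0].
  have dfi i j z : i != j -> z \in f i -> z \notin f j.
    by move=> ij zi; apply: contra ij => /(df i j z zi) ->.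
  case: (boolP [exists i, v \in f i]) => [/existsP[i vi] | /existsPn vf].
    by exists i, (f i); split=> // j z; apply: dfi.
  case: (boolP ((v \in A) && (v \in B))) => [/andP[vA vB] | vAB].
    exists (Ordinal k_gt0), [:: v]; split; rewrite ?mem_head //=.
      by rewrite !inE vA vB.
    by move=> i z _ zi; rewrite inE; apply: contraNneq (vf i) => <-.
  exists (Ordinal k_gt0), (f (Ordinal k_gt0)); split=> //; last by move=> j z; apply: dfi.
  by move=> vA vB; rewrite vA vB in vAB.
have [x [h h0E]] : exists x h, h0 = x :: h by case: (h0) ch0 => // x h _; exists x, h.
have hA z : z \in h0 -> z \in A -> z = x.
  by move=> zh zA; rewrite (clean_path_head x ch0 zh) ?inE // h0E.
have hB z : z \in h0 -> z \in B -> z = last x h.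
  by move=> zh zB; rewrite (clean_path_last x ch0 zh) ?inE // h0E.
have [xA xh yB] : [/\ x \in A, path e x h & last x h \in B].
  by move: (clean_path_ab ch0); rewrite h0E /= !inE => /and3P[].
(* A one-vertex link would be a common vertex, hence [v], which is on the hub; so the other links
   have two ends. The value at [i0] is a dummy. *)
have [l lP] : exists l : 'I_k -> link T, forall i, i != i0 ->
    f i = (l i).1.1 :: rcons (l i).1.2 (l i).2.
  apply: (@fin_all_exists _ _ (fun i l => i != i0 -> f i = l.1.1 :: rcons l.1.2 l.2)) => i.
  have := cf i; case fiE: (f i) => [|a s] // cfi.
  case: (eqVneq i i0) => [_ | ii0]; first by exists (v, [::], v).
  case/lastP: s fiE cfi => [|s b] fiE cfi; last by exists (a, s, b).
  move: (clean_path_ab cfi); rewrite /= !inE => /andP[aA aB].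
  have ai : a \in f i by rewrite fiE mem_head.
  by move: (dh0 i a ii0 ai); rewrite (ABv a aA aB) vh0 // -(ABv a aA aB).
pose I := [seq i <- enum 'I_k | i != i0]; pose L := map l I.
have uI : uniq I by rewrite filter_uniq // enum_uniq.
have I0 i : (i \in I) = (i != i0) by rewrite mem_filter mem_enum andbT.
have srcP i : i \in I -> [/\ (l i).1.1 \in f i, (l i).1.1 \in A & (l i).1.1 != x].
  rewrite I0 => ii0; have fiE := lP i ii0.
  have si : (l i).1.1 \in f i by rewrite fiE mem_head.
  have sA : (l i).1.1 \in A.
    by have := clean_path_ab (cf i); rewrite fiE /= => /andP[+ _]; rewrite inE.
  split=> //.
  by apply: contraNneq (dh0 i _ ii0 si) => sE; rewrite -?sE ?sE; rewrite h0E mem_head.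
have dstP i : i \in I -> [/\ (l i).2 \in f i, (l i).2 \in B & (l i).2 != last x h].
  rewrite I0 => ii0; have fiE := lP i ii0.
  have si : (l i).2 \in f i by rewrite fiE inE mem_rcons mem_head orbT.
  have sB : (l i).2 \in B.
    by have := clean_path_ab (cf i); rewrite fiE /= last_rcons => /and3P[_ _]; rewrite inE.
  split=> //.
  by apply: contraNneq (dh0 i _ ii0 si) => sE; rewrite -?sE ?sE; rewrite h0E mem_last.
have innP i z : i \in I -> z \in (l i).1.2 -> [/\ z \in f i, z \notin A & z \notin B].
  rewrite I0 => ii0 zi; have fiE := lP i ii0.
  have zf : z \in f i by rewrite fiE inE mem_rcons inE zi !orbT.
  have [n1 n2] : (l i).1.1 \notin (l i).1.2 /\ (l i).2 \notin (l i).1.2.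
    have := clean_path_uniq (cf i).
    by rewrite fiE /= mem_rcons rcons_uniq inE negb_or => /and3P[/andP[_ n1] n2 _].
  split=> //; apply/negP => zAB.
    suff zE : z = (l i).1.1 by rewrite -zE zi in n1.
    by rewrite (clean_path_head x (cf i) zf) ?inE // fiE.
  suff zE : z = (l i).2 by rewrite -zE zi in n2.
  by rewrite (clean_path_last x (cf i) zf) ?inE // fiE /= last_rcons.
have split_at (u : T) (C : seq T) : u \in C -> exists C1 C2, C = rev C1 ++ u :: C2 /\ perm_eq C (u :: C1 ++ C2).
  case/splitPr => C1 C2; exists (rev C1), C2; rewrite revK; split=> //.
  by apply/permP => p; rewrite /= !(count_cat, count_rev) /= addnCA.
have [A1 [A2 [AE Aperm]]] := split_at x A xA.
have [B1 [B2 [BE Bperm]]] := split_at _ B yB.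
have := uA; rewrite (perm_uniq Aperm) cons_uniq => /andP[xA12 uA12].
have := uB; rewrite (perm_uniq Bperm) cons_uniq => /andP[yB12 uB12].
have memA z : (z \in A) = (z == x) || (z \in A1 ++ A2) by rewrite (perm_mem Aperm) inE.
have memB z : (z \in B) = (z == last x h) || (z \in B1 ++ B2) by rewrite (perm_mem Bperm) inE.
exists A1, x, A2, B1, B2, h, L; split=> //.
- split.
  + apply/allP => _ /mapP[i iI ->]; rewrite I0 in iI.
    by move: (clean_path_ab (cf i)); rewrite (lP i iI) /= => /and3P[].
  + rewrite /sources -map_comp map_inj_in_uniq // => i j /srcP[fi _ _] /srcP[fj _ _] /= ij.
    by rewrite ij in fi; apply: df fi fj.
  + rewrite /targets -map_comp map_inj_in_uniq // => i j /dstP[fi _ _] /dstP[fj _ _] /= ij.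
    by rewrite ij in fi; apply: df fi fj.
  + move=> _ /mapP[_ /mapP[i iI ->] ->]; have [_ + /negPf sx] := srcP i iI.
    by rewrite memA sx.
  + move=> _ /mapP[_ /mapP[i iI ->] ->]; have [_ + /negPf sx] := dstP i iI.
    by rewrite memB sx.
- rewrite size_map size_filter; have := count_predC (pred1 i0) (enum 'I_k).
  by rewrite count_uniq_mem ?enum_uniq // mem_enum size_enum_ord => /(congr1 predn) /= <-.
have uL : uniq (inner L).
  rewrite /inner -map_comp; apply: uniq_flatten_map => // [i iI | i j z iI jI /= zi zj].
    rewrite I0 in iI; have := clean_path_uniq (cf i).
    by rewrite (lP i iI) /= rcons_uniq => /and3P[].
  have [fi _ _] := innP i z iI zi; have [fj _ _] := innP j z jI zj; exact: df fi fj.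
have innL z : z \in inner L -> [/\ z \notin h0, z \notin A & z \notin B].
  case/flatten_mapP=> _ /mapP[i iI ->] zi; have [fi zA zB] := innP i z iI zi.
  by split=> //; apply: (dh0 i) => //; rewrite -I0.
have h0A : ~~ has (mem h0) (A1 ++ A2).
  apply/hasPn => z zA12; apply: contra xA12 => /= /hA <- //.
  by rewrite memA zA12 orbT.
have h0B : ~~ has (mem h0) (B1 ++ B2).
  apply/hasPn => z zB12; apply: contra yB12 => /= /hB <- //.
  by rewrite memB zB12 orbT.
(* A vertex common to the arms would be [v], which lies on the hub and so is [x]. *)
have AB : ~~ has (mem (A1 ++ A2)) (B1 ++ B2).
  apply/hasPn => z zB12; apply: contra xA12 => /= zA12.
  have zA : z \in A by rewrite memA zA12 orbT.
  have zB : z \in B by rewrite memB zB12 orbT.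
  have zv := ABv z zA zB; rewrite zv in zA zB zA12.
  by rewrite -(hA v) // vh0.
rewrite -h0E (cat_uniq h0) (cat_uniq (A1 ++ A2)) (cat_uniq (B1 ++ B2)).
rewrite (clean_path_uniq ch0) uA12 uB12 uL !andbT /=.
rewrite !(has_cat _ (A1 ++ A2)) !(has_cat _ (B1 ++ B2)) !negb_or h0A h0B AB /=.
apply/and3P; split; apply/hasPn => z /innL[zh zA zB] //=.
  by apply: contra zA; rewrite memA orbC => ->.
by apply: contra zB; rewrite memB orbC => ->.
Qed.
End HubAndLinks.

(** * Long paths meet twice *)

Section Connectivity.
Variables (T : finType) (e : rel T) (k : nat).
Hypotheses (esym : symmetric e) (eirr : irreflexive e).
Hypotheses (k_gt0 : 0 < k) (ekconn : k_connected e k).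

Lemma connect_leave (r : rel T) (D : {set T}) a b : connect r a b -> a \in D -> b \notin D ->
  exists u w, [/\ u \in D, w \notin D & r u w].
Proof.
move=> /connectP[s + ->]; elim: s a => [|u s IH] a /=; first by move=> _ ->.
move=> /andP[au us] aD; case: (boolP (u \in D)) => [uD | uD _]; first exact: IH.
by exists a, u.
Qed.

Lemma connected_leave (D : {set T}) a b : a \in D -> b \notin D ->
  exists u w, [/\ u \in D, w \notin D & e u w].
Proof.
move=> aD bD; have := ekconn.2 set0; rewrite cards0 => /(_ k_gt0 a b).
rewrite !inE => /(_ isT isT) /connect_leave /(_ aD bD)[u [w [uD wD /and3P[uw _ _]]]].
by exists u, w.
Qed.

(** Deleting fewer than [k] neighbours would cut [x] off from a remaining vertex, which exists as
    [k < #|T|]. *)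
Lemma k_connected_degree x : k <= #|[set y | e x y]|.
Proof.
rewrite leqNgt; apply/negP => Sk; have [kT /(_ _ Sk x) conn] := ekconn.
have xS : x \notin [set y | e x y] by rewrite inE eirr.
have /subsetPn[y _] : ~~ ([set: T] \subset x |: [set y | e x y]).
  apply/negP => /subset_leq_card; rewrite cardsT cardsU1 xS.
  by move: kT Sk; clear; lia.
rewrite inE negb_or => /andP[yx yS].
have := conn y xS yS => /connect_leave /(_ (set11 x) yx).
by case=> u [w [/set1P -> _ /and3P[xw _]]]; rewrite inE xw.
Qed.

Lemma is_gpath_neighbor_closed p x s z : longest_path_length e p ->
  is_gpath e (x :: s) -> size s = p -> e x z -> z \in x :: s.
Proof.
move=> [_ longest] /andP[xs us] sp xz; apply: contraT => zxs.
have := longest [:: z, x & s]; rewrite /is_gpath cons_uniq zxs us /= esym xz xs /plength /= sp ltnn.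
by move/(_ isT).
Qed.

(** Two crossing chords replace the path edge between [last x s] and [v]. *)
Lemma cycle_close x s v t : path e x (s ++ v :: t) -> e x v -> e (last x s) (last v t) ->
  cycle e (x :: s ++ rev (v :: t)).
Proof.
rewrite cat_path /= rcons_cat cat_path => /and3P[-> _ vt] xv uy /=.
by apply: path_rev => //; rewrite rcons_path /= xv vt esym.
Qed.

(* Dirac: otherwise the neighbourhoods of both ends of a longest path force a
   cycle through all its vertices, which an edge leaving it would extend. *)
Lemma longest_path_dirac p : longest_path_length e p -> #|T| <= p.+1 \/ k.*2 <= p.
Proof.
move=> lp; have [[[|x s] [gs sp]] longest] := lp; first by [].
rewrite /plength /= in sp; have /andP[xs us] := gs.
case: (leqP #|T| p.+1) => [|pT]; [by left | right; rewrite leqNgt; apply/negP => pk].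
(* The indices are shifted: [i] in [R] makes [x] adjacent to path vertex [i.+1], [i] in [Q] makes
   the other end adjacent to vertex [i]. A common index gives crossing chords. *)
pose R := [set i : 'I_p | e x (nth x s i)].
pose Q := [set i : 'I_p | e (last x s) (nth x (x :: s) i)].
have kR : k <= #|R|.
  apply: leq_trans (k_connected_degree x) _.
  apply: leq_trans (leq_imset_card (fun i : 'I_p => nth x s i) (mem R)).
  apply: subset_leq_card; apply/subsetP => z; rewrite inE => xz.
  have := is_gpath_neighbor_closed lp gs sp xz; rewrite inE.
  case/orP => [/eqP zx | zs]; first by rewrite zx eirr in xz.
  have iz : index z s < p by rewrite -sp index_mem.
  by apply/imsetP; exists (Ordinal iz); rewrite ?inE /= nth_index.
have kQ : k <= #|Q|.
  apply: leq_trans (k_connected_degree (last x s)) _.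
  apply: leq_trans (leq_imset_card (fun i : 'I_p => nth x (x :: s) i) (mem Q)).
  apply: subset_leq_card; apply/subsetP => z; rewrite inE => yz.
  have gr : is_gpath e (last x s :: rev (belast x s)).
    rewrite /is_gpath -rev_rcons -lastI rev_uniq us andbT rev_path.
    by rewrite (eq_path (e' := e)) // => u w; rewrite /= esym.
  have sr : size (rev (belast x s)) = p by rewrite size_rev size_belast.
  have := is_gpath_neighbor_closed lp gr sr yz; rewrite inE mem_rev.
  case/orP => [/eqP zy | zs]; first by rewrite zy eirr in yz.
  have iz : index z (belast x s) < p by rewrite -sp -(size_belast x s) index_mem.
  have nz : nth x (x :: s) (index z (belast x s)) = z.
    by rewrite lastI nth_rcons size_belast sp iz nth_index.
  by apply/imsetP; exists (Ordinal iz); rewrite ?inE /= ?nz.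
have /set0Pn[i] : R :&: Q != set0.
  rewrite -card_gt0; have RQ : #|R :|: Q| <= p by rewrite -[p in _ <= p]card_ord max_card.
  by move: (cardsUI R Q) RQ kR kQ pk; clear; lia.
rewrite !inE => /andP[xv uy].
have iE : last x (take i s) = nth x (x :: s) i.
  by rewrite (last_nth x) size_takel ?sp ?(ltnW (ltn_ord i)) // -[_ :: take _ _]/(take i.+1 (x :: s)) nth_take.
have sE : s = take i s ++ nth x s i :: drop i.+1 s by rewrite -drop_nth ?cat_take_drop ?sp.
have lE : last (nth x s i) (drop i.+1 s) = last x s by rewrite [in RHS]sE last_cat.
pose C := x :: take i s ++ rev (nth x s i :: drop i.+1 s).
have cC : cycle e C by apply: cycle_close; rewrite -?sE // iE lE esym.
have pC : perm_eq C (x :: s).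
  by rewrite [in X in perm_eq _ X]sE perm_cons perm_cat2l perm_rev.
have uC : uniq C by rewrite (perm_uniq pC).
have [w wC] : exists w, w \notin C.
  have /subsetPn[w _ wC] : ~~ ([set: T] \subset [set z in C]).
    apply/negP => /subset_leq_card; rewrite cardsT cardsE (card_uniqP uC) (perm_size pC) /= sp.
    by rewrite leqNgt pT.
  by exists w; rewrite inE in wC.
(* An edge leaving the cycle, followed by the opened cycle, is a path of length [p.+1]. *)
have [||c [z [c_C z_C cz]]] := @connected_leave [set u in C] x w; rewrite ?inE ?eqxx //.
rewrite !in_set in c_C z_C.
have [j C' rotC] := rot_to c_C.
have := cC; rewrite -(rot_cycle j) rotC /= rcons_path => /andP[cC' _].
have uzC : uniq [:: z, c & C'] by rewrite cons_uniq -rotC mem_rot z_C rot_uniq.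
have := longest [:: z, c & C']; rewrite /is_gpath uzC /= esym cz cC' /plength /=.
move=> /(_ isT); rewrite -[(size C').+1]/(size (c :: C')) -rotC size_rot (perm_size pC) /= sp.
by rewrite ltnn.
Qed.

Lemma longest_path_geq p : longest_path_length e p -> k <= p.
Proof.
move=> lp; have [Tp|] := longest_path_dirac lp; first by move: ekconn.1 Tp; clear; lia.
by clear; lia.
Qed.

Lemma long_paths_meet p t A B v : longest_path_length e p -> t_bound k p t ->
  is_gpath e A -> is_gpath e B ->
  p + 1 <= plength A + t -> p + 1 <= plength B + t ->
  (forall z, z \in A -> z \in B -> z = v) -> False.
Proof.
move=> lp tb gA gB pA pB ABv.
have szP s : is_gpath e s -> size s = (plength s).+1 by case: s.
have t2k := t_bound_double tb; have kp := longest_path_geq lp.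
(* In a graph on at most [p.+1] vertices, two paths with at least [p + 2 - t] vertices each would
   share more than one, since [t.*2 < k.+2 <= p.+2]. *)
have k2p : k.*2 <= p.
  have [Tp|//] := longest_path_dirac lp.
  have uniq_gpath s : is_gpath e s -> uniq s by case: s => // a s /andP[].
  have cI : #|[set z in A] :&: [set z in B]| <= 1.
    rewrite -(cards1 v); apply: subset_leq_card; apply/subsetP => z.
    by rewrite !inE => /andP[zA zB]; rewrite (ABv z zA zB).
  have card_seq s : is_gpath e s -> #|[set z in s]| = (plength s).+1.
    by move=> gs; rewrite cardsE (card_uniqP (uniq_gpath s gs)) szP.
  have := cardsUI [set z in A] [set z in B]; rewrite !card_seq //.
  have cU : #|[set z in A] :|: [set z in B]| <= #|T| by exact: max_card.
  by move: Tp cI cU pA pB kp t2k; clear; lia.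
have kA : k <= size A by rewrite szP //; move: pA k2p t2k; clear; lia.
have kB : k <= size B by rewrite szP //; move: pB k2p t2k; clear; lia.
have [A1 [x [A2 [B1 [B2 [h [L [[AE BE] xh LL sL uall]]]]]]]] :=
  hub_and_links eirr ekconn k_gt0 gA gB ABv kA kB.
subst A B; move: gA gB; rewrite !is_gpath_cat -!rev_cons !sorted_rev //=.
move=> /andP[/andP[xA1 xA2] _] /andP[/andP[yB1 yB2] _].
have [m [m' [s [s' [gs gs' capL ss ss']]]]] := crossing esym xh xA1 xA2 yB1 yB2 LL uall.
have plength_cat (s1 s2 : seq T) u : plength (rev s1 ++ u :: s2) = size s1 + size s2.
  by rewrite /plength size_cat size_rev addnS.
rewrite !plength_cat in pA pB; rewrite sL in capL.
apply: (crossing_arith tb pA pB capL).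
  exact: leq_trans ss (lp.2 s gs).
exact: leq_trans ss' (lp.2 s' gs').
Qed.

End Connectivity.

(** * Bonds with connected sides *)

Section Bonds.
Variables (T : finType) (e : rel T) (k : nat).
Hypotheses (esym : symmetric e) (k_gt1 : 1 < k) (ekconn : k_connected e k).
Implicit Types X Y Z : {set T}.

Let k_gt0 : 0 < k := ltnW k_gt1.

Definition within X a b := [&& e a b, a \in X & b \in X].
Arguments within X a b /.
Definition conn X := forall a b, a \in X -> b \in X -> connect (within X) a b.

Lemma within_connect_sym X : connect_sym (within X).
Proof. by apply: sym_connect_sym => a b; rewrite /= esym [(a \in X) && _]andbC. Qed.

Lemma within_connect_mem X a b : connect (within X) a b -> a \in X -> b \in X.
Proof.
move=> ab aX; apply: contraT => bX.
by have [u [w [_ wX /and3P[_ _ /negPn]]]] := connect_leave ab aX bX; rewrite wX.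
Qed.

Lemma edge_cut_mem X x y : e x y ->
  ([set x; y] \in edge_cut e X) = ((x \in X) != (y \in X)).
Proof.
move=> xy; apply/imset2P/idP => [[a b aX] | ].
  rewrite !inE => /andP[bX _] /setP xyab.
  have := xyab a; have := xyab b; rewrite !inE !eqxx orbT /=.
  by case/orP=> /eqP bE; case/orP=> /eqP aE; move: aX bX; rewrite aE bE;
    case: (x \in X); case: (y \in X).
case: (boolP (x \in X)) => xX; case: (boolP (y \in X)) => yX // _.
  by exists x y; rewrite ?inE ?yX.
exists y x => //; first by rewrite !inE xX esym.
by rewrite setUC.
Qed.

(** If the cut of [Z] lies inside that of [X], no edge within a side crosses [Z]. By connectedness
    [Z] contains or misses each side entirely, so the two cuts agree. *)
Lemma edge_cut_connected_bond X a b : conn X -> conn (~: X) -> a \in X -> b \notin X ->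
  is_bond e (edge_cut e X).
Proof.
move=> cX cY aX bX; split; first by exists X.
  have [u [w [uX wX uw]]] := connected_leave k_gt0 ekconn aX bX.
  by apply/set0Pn; exists [set u; w]; rewrite edge_cut_mem // uX (negPf wX).
move=> _ [Z ->] /set0Pn[f fZ] sub.
have side Y : Y = X \/ Y = ~: X -> forall u w, u \in Y -> w \in Y -> u \in Z -> w \in Z.
  move=> YX u w uY wY uZ; apply: contraT => wZ.
  have cY' : connect (within Y) u w by case: YX uY wY => ->; [apply: cX | apply: cY].
  have [u' [w' [uZ' wZ' /and3P[uw' uY' wY']]]] := connect_leave cY' uZ wZ.
  have : [set u'; w'] \in edge_cut e X.
    by apply: (subsetP sub); rewrite edge_cut_mem // uZ' (negPf wZ').
  rewrite edge_cut_mem //; case: YX uY' wY' => ->; rewrite ?inE; first by move=> -> ->.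
  by move=> /negPf -> /negPf ->.
have sideX := side X (or_introl erefl); have sideY := side (~: X) (or_intror erefl).
case/imset2P: fZ sub => u w uZ; rewrite !inE => /andP[wZ uw] _ sub.
have : [set u; w] \in edge_cut e X.
  by apply: (subsetP sub); rewrite edge_cut_mem // uZ (negPf wZ).
rewrite edge_cut_mem // => uwX.
apply/eqP; rewrite eqEsubset sub; apply/subsetP => _ /imset2P[c d cX1 + ->].
rewrite !inE => /andP[dX cd]; rewrite edge_cut_mem //.
case: (boolP (u \in X)) uwX => [uX | uX]; case: (boolP (w \in X)) => // wX _.
  have -> : c \in Z by apply: sideX uX cX1 uZ.
  by rewrite eq_sym; apply: contra wZ => /eqP dZ; apply: sideY dZ; rewrite inE.
have -> : d \in Z by apply: sideY uZ; rewrite inE.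
by apply: contra wZ => /eqP cZ; apply: sideX cZ.
Qed.

Lemma meets_edge_cutN X s : is_gpath e s -> ~~ meets (edge_cut e X) s ->
  {subset s <= X} \/ {subset s <= ~: X}.
Proof.
case: s => // x s /andP[xs _] no_meet.
have same z : z \in x :: s -> (z \in X) = (x \in X).
  move: xs no_meet; rewrite /meets /=; elim: s x => [|y s IH] x /=.
    by move=> _ _; rewrite inE => /eqP ->.
  move=> /andP[xy ys]; rewrite edge_cut_mem // negb_or negbK => /andP[/eqP xX nys].
  by rewrite inE => /orP[/eqP -> // | /(IH _ ys nys) ->].
case: (boolP (x \in X)) => xX; [left | right] => z /same zX; first by rewrite zX.
by rewrite inE zX.
Qed.

Lemma conn_add Y v w : conn Y -> w \in Y -> e v w -> conn (v |: Y).
Proof.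
move=> cY wY vw.
have sub : subrel (within Y) (within (v |: Y)).
  by move=> a b /and3P[ab aY bY]; rewrite /= ab !inE aY bY !orbT.
have to_w a : a \in v |: Y -> connect (within (v |: Y)) a w.
  case/setU1P=> [-> | aY]; first by apply: connect1; rewrite /= vw !inE eqxx wY orbT.
  have := cY a w aY wY; apply: connect_sub => x y xy; exact/connect1/sub.
move=> a b aY bY; apply: connect_trans (to_w a aY) _.
by rewrite within_connect_sym; apply: to_w.
Qed.

(* The pair [(v, c)] maximises the component of [c] in [X :\ v]: a second
   component would contain a better choice of [v]. *)
Lemma removable_vertex X b : conn X -> 1 < #|X| -> b \notin X ->
  exists v w, [/\ v \in X, w \notin X, e v w & conn (X :\ v)].
Proof.
move=> cX X_gt1 bX.
pose comp (p : T * T) := [set z | connect (within (X :\ p.1)) p.2 z].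
(* The neighbour outside [X] will keep the complement connected once the vertex has moved there. *)
pose P (p : T * T) := [&& p.1 \in X, p.2 \in X :\ p.1 & [exists w, (w \notin X) && e p.1 w]].
have [v0 [c0 P0]] : exists v c, P (v, c).
  have /card_gt0P[a aX] : 0 < #|X| by apply: ltnW.
  have [v [w [vX wX vw]]] := connected_leave k_gt0 ekconn aX bX.
  have /card_gt0P[c cXv] : 0 < #|X :\ v| by move: X_gt1; rewrite (cardsD1 v) vX.
  by exists v, c; rewrite /P /= vX cXv; apply/existsP; exists w; rewrite wX.
case: (arg_maxnP (fun p => #|comp p|) P0) => -[v c] /and3P[/= vX cX' /existsP[w /andP[wX vw]]] maxP.
suff compE d : d \in X :\ v -> d \in comp (v, c).
  exists v, w; split=> // a d /compE ca /compE cd; rewrite !inE /= in ca cd.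
  by apply: connect_trans cd; rewrite within_connect_sym.
move=> dX; apply: contraT; rewrite inE /= => cd.
have kv : #|[set v]| < k by rewrite cards1.
have [dv cv] : d \notin [set v] /\ c \notin [set v].
  by move: dX cX'; rewrite !inE => /andP[-> _] /andP[-> _].
have cD : c \notin comp (v, d) by rewrite inE within_connect_sym.
have dD : d \in comp (v, d) by rewrite inE connect0.
(* The graph without [v] is connected, so an edge leaves the component of [d]. It must leave [X] as
   well, which makes [u] a candidate. *)
have [u [x [uD xD /and3P[ux uv xv]]]] := connect_leave (ekconn.2 _ kv d c dv cv) dD cD.
rewrite inE /= in uD.
have uXv := within_connect_mem uD dX.
have uX : u \in X by move: uXv; rewrite inE => /andP[].
have cu : ~~ connect (within (X :\ v)) c u.
  by apply: contra cd => cu; apply: connect_trans cu _; rewrite within_connect_sym.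
have xX : x \notin X.
  apply: contra xD => xX; rewrite inE /=; apply: connect_trans uD _; apply: connect1.
  by rewrite /= ux uXv !inE xX -in_set1 xv.
have cXu : c \in X :\ u.
  move: cX'; rewrite !inE => /andP[_ ->]; rewrite andbT.
  by apply: contraNneq cu => ->; apply: connect0.
have Puc : P (u, c) by rewrite /P /= uX cXu; apply/existsP; exists x; rewrite xX.
have grow z : connect (within (X :\ v)) c z -> connect (within (X :\ u)) c z.
  move=> cz; apply: contraT => ncz.
  pose D := [set y | connect (within (X :\ u)) c y && connect (within (X :\ v)) c y].
  have [||y1 [y2 [y1D y2D y12]]] := @connect_leave _ _ D _ _ cz.
    - by rewrite inE !connect0.
    - by rewrite inE negb_and ncz.
  move: y1D y2D; rewrite !inE => /andP[cy1 cy1'].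
  have cy2 : connect (within (X :\ v)) c y2 by apply: connect_trans cy1' (connect1 y12).
  rewrite cy2 andbT => /negP[]; apply: connect_trans cy1 (connect1 _).
  move: y12 => /and3P[/= -> ]; rewrite !inE => /andP[_ ->] /andP[_ ->] /=; rewrite !andbT.
  by apply/andP; split; [apply: contraNneq cu => <- | apply: contraNneq cu => <-].
have cXc : c \in X by move: cX'; rewrite inE => /andP[].
(* An edge within [X] leaving the component of [c] can only end in [v], so deleting [u] instead adds
   [v] to that component. *)
have growv : connect (within (X :\ u)) c v.
  have [||y1 [y2 [y1D y2D /and3P[y12 y1X y2X]]]] := @connect_leave _ _ (comp (v, c)) _ _ (cX c v cXc vX).
  - by rewrite inE connect0.
  - rewrite inE /=; apply/negP => /within_connect_mem /(_ cX').
    by rewrite !inE eqxx.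
  rewrite inE /= in y1D; have y1v := within_connect_mem y1D cX'.
  have y2v : y2 = v.
    apply/eqP; apply: contraNT y2D => y2v; rewrite inE /=; apply: connect_trans y1D (connect1 _).
    by rewrite /= y12 y1v !inE y2v y2X.
  have y1u : y1 != u by apply: contraNneq cu => <-.
  have vu : v != u by apply: contraNneq uv => ->; rewrite set11.
  apply: connect_trans (grow _ y1D) (connect1 _).
  by rewrite /= -y2v y12 !inE y1X y2X y2v y1u vu.
have := maxP _ Puc; rewrite leqNgt => /negP[]; apply: proper_card; apply/properP; split.
  by apply/subsetP => z; rewrite !inE; apply: grow.
exists v; rewrite inE //=; apply/negP => /within_connect_mem /(_ cX').
by rewrite !inE eqxx.
Qed.

End Bonds.

(** * The parameter t and the descent to a bond *)

Lemma t_paramP k p : 3 <= k -> t_bound k p (t_param k p).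
Proof.
move=> k3; rewrite /t_bound /t_param; set r := sq_param k.
pose q : algC := ((k - 2)%:R / 2%:R)%R.
have q_gt0 : (0 < q)%R by rewrite divr_gt0 ?ltr0n // subn_gt0.
have r_gt0 : (0 < r)%R by rewrite sqrtC_gt0.
have r_real : r \is Num.real by apply: gtr0_real.
have r2 : (r ^+ 2 * 2%:R = (k - 2)%:R)%R by rewrite sqrtCK divfK // pnatr_eq0.
case: (odd p).
  have c_gt0 : (0 < Num.ceil r)%R by rewrite ceil_gt0.
  have [n cE] : exists n : nat, Num.ceil r = Posz n.+1.
    by case: (Num.ceil r) c_gt0 => // [] [|n] // _; exists n.
  (* [n] is the ceiling minus one, so it lies strictly below the root, and squaring keeps this
     strict. *)
  have nr : (n%:R < r)%R.
    by have := real_ceilB1_lt r_real; rewrite cE -addn1 PoszD addrK.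
  rewrite cE absz_nat; split=> //=.
  have : ((n ^ 2 * 2)%:R < (k - 2)%:R :> algC)%R.
    rewrite -r2 natrM natrX ltr_pM2r ?ltr0n // ltrXn2r ?ler0n ?ltW //.
  by rewrite ltr_nat; move: k3; clear; lia.
have f_ge0 : (0 <= Num.floor r)%R by rewrite real_floor_ge0 // ltW.
have [n fE] : exists n : nat, Num.floor r = Posz n.
  by case: (Num.floor r) f_ge0 => // n _; exists n.
have nr : (n%:R <= r)%R by have := real_floor_le r_real; rewrite fE.
rewrite fE absz_nat.
have : ((n ^ 2 * 2)%:R <= (k - 2)%:R :> algC)%R.
  by rewrite -r2 natrM natrX ler_pM2r ?ltr0n // lerXn2r ?nnegrE ?ler0n // ltW.
by rewrite ler_nat; move: k3; clear; lia.
Qed.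

Theorem theorem5 (T : finType) (e : rel T) (k p : nat) :
  simple_graph e -> 3 <= k -> k_connected e k -> longest_path_length e p ->
  exists B : {set {set T}},
    is_bond e B /\
    forall s : seq T, is_gpath e s -> p + 1 <= plength s + t_param k p ->
      meets B s.
Proof.
move=> [e_sym e_irr] k3 ekconn lp; apply: NNPP => no_bond.
have k_gt0 : 0 < k by move: k3; clear; lia.
have k_gt1 : 1 < k by move: k3; clear; lia.
have tb := t_paramP p k3; move: (t_param k p) tb no_bond => t tb no_bond.
pose long s := is_gpath e s /\ p + 1 <= plength s + t.
(* As [t.*2 < k.+2] and [k <= p], a long path has at least two vertices, so a side holding one can
   lose a vertex. *)
have long_card s (X : {set T}) : long s -> {subset s <= X} -> 1 < #|X|.
  move=> [gs ps] sX; have us : uniq s by case: (s) gs => // a s' /andP[].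
  apply: (@leq_trans (size s)); last first.
    by rewrite -(card_uniqP us); apply: subset_leq_card; apply/subsetP.
  move: (longest_path_geq e_sym e_irr k_gt0 ekconn lp) (t_bound_double tb) ps.
  by rewrite /plength; clear; lia.
have side X a b : conn e X -> conn e (~: X) -> a \in X -> b \notin X ->
    exists2 s, long s & {subset s <= X} \/ {subset s <= ~: X}.
  move=> cX cY aX bX; apply: NNPP => no_s; apply: no_bond.
  exists (edge_cut e X); split; first exact: (edge_cut_connected_bond e_sym k_gt1 ekconn cX cY aX bX).
  move=> s gs ps; apply: contraT => /(meets_edge_cutN e_sym gs) sX.
  by case: no_s; exists s.
(* Descent on [#|X|]: after a removable vertex [v] has moved across, a long path lies either in the
   smaller side, and the descent goes on, or in the other, where it shares at most [v] with [A]. *)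
have shrink (X : {set T}) b A : conn e X -> conn e (~: X) -> b \notin X ->
    long A -> {subset A <= X} -> False.
  have [n] := ubnP #|X|; elim: n X b A => // n IH X b A Xn cX cY bX lA AX.
  have X_gt1 := long_card A X lA AX.
  have [v [w [vX wX vw cXv]]] := removable_vertex e_sym k_gt1 ekconn cX X_gt1 bX.
  have cYv : conn e (~: (X :\ v)).
    have -> : ~: (X :\ v) = v |: ~: X by rewrite setDE setCI setCK setUC.
    by apply: (conn_add e_sym cY (w := w)); rewrite ?inE.
  have vXv : v \notin X :\ v by rewrite setD11.
  have cardX : #|X| = #|X :\ v|.+1 by rewrite (cardsD1 v) vX.
  have /card_gt0P[a aXv] : 0 < #|X :\ v| by move: X_gt1; rewrite cardX.
  have [s ls [sX | sY]] := side _ _ _ cXv cYv aXv vXv.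
    by apply: (IH (X :\ v) v s) => //; move: Xn; rewrite cardX.
  apply: (long_paths_meet (A := A) (B := s) (v := v) e_sym e_irr k_gt0 ekconn lp tb);
    rewrite ?lA.1 ?lA.2 ?ls.1 ?ls.2 // => z /AX zX /sY.
  by rewrite !inE zX andbT negbK => /eqP.
have /card_gt0P[u _] : 0 < #|T| by move: ekconn.1; clear; lia.
(* The descent starts from all vertices but one: this side is connected since [1 < k], and a single
   vertex is too small for a long path. *)
have cC : conn e (~: [set u]).
  move=> a b; rewrite !inE => au bu.
  have := ekconn.2 [set u]; rewrite cards1 => /(_ k_gt1 a b); rewrite !inE => /(_ au bu).
  by apply: connect_sub => x y xy; apply: connect1; move: xy; rewrite /within /= !inE.
have c1 : conn e (~: ~: [set u]) by rewrite setCK => a b /set1P -> /set1P ->.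
have uC : u \notin ~: [set u] by rewrite !inE eqxx.
have /card_gt0P[a aC] : 0 < #|~: [set u]|.
  by have := cardsC [set u]; rewrite cards1; move: ekconn.1 k3; clear; lia.
have [s ls [sC | ]] := side _ _ _ cC c1 aC uC; first exact: (shrink _ _ s cC c1 uC ls sC).
by rewrite setCK => /(long_card s _ ls); rewrite cards1.
Qed.
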